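(* Let $R$ be a unitary ring and let $a,b,d\in R$ be such that $b$ is an outer inverse of $a$ and $d$ is regular. Then the following statements are equivalent. (i) $b$ is the inverse of $a$ along $d$. (ii) $Rd=Rb$, $dR\subseteq bR$ and $d_{-1}(0)\subseteq b_{-1}(0)$. (iii) $bR=dR$, $Rd\subseteq Rb$ and $d^{-1}(0)\subseteq b^{-1}(0)$. (iv) $Rb=Rd$ and $b_{-1}(0)=d_{-1}(0)$. (v) $Rb\subseteq Rd$, $dR\subseteq bR$, $b^{-1}(0)\subseteq d^{-1}(0)$ and $d_{-1}(0)\subseteq b_{-1}(0)$. (vi) $Rd\subseteq Rb$, $bR\subseteq dR$, $b_{-1}(0)\subseteq d_{-1}(0)$ and $d^{-1}(0)\subseteq b^{-1}(0)$. (vii) $Rd\subseteq Rb$, $dR\subseteq bR$, $d^{-1}(0)\subseteq b^{-1}(0)$ and $d_{-1}(0)\subseteq b_{-1}(0)$. (viii) $bR=dR$ and $b^{-1}(0)=d^{-1}(0)$. (ix) $Rb\subseteq Rd$, $b^{-1}(0)\subseteq d^{-1}(0)$ and $b_{-1}(0)=d_{-1}(0)$. (x) $Rd\subseteq Rb$, $d^{-1}(0)\subseteq b^{-1}(0)$ and $b_{-1}(0)=d_{-1}(0)$. (xi) $dR\subseteq bR$, $d_{-1}(0)\subseteq b_{-1}(0)$ and $b^{-1}(0)=d^{-1}(0)$. (xii) $bR\subseteq dR$, $b_{-1}(0)\subseteq d_{-1}(0)$ and $b^{-1}(0)=d^{-1}(0)$. (xiii) $b^{-1}(0)=d^{-1}(0)$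 and $b_{-1}(0)=d_{-1}(0)$.
   Context: $R$ is an associative ring with unit $1$. For $c\in R$: $cR=\{cx: x\in R\}$, $Rc=\{xc: x\in R\}$, $c^{-1}(0)=\{x\in R: cx=0\}$, $c_{-1}(0)=\{x\in R: xc=0\}$. An element $d$ is regular if there is $z\in R$ with $d=dzd$. An element $b$ is an outer inverse of $a$ if $b=bab$. An element $a$ is invertible along $d$ if there is $b\in R$ with $b=bab$, $bR=dR$ and $Rb=Rd$; such $b$ is unique and is called the inverse of $a$ along $d$. *)

(* Defs.v *)
From HB Require Import structures.
From mathcomp Require Import all_boot all_algebra.
From mathcomp Require Import boolp classical_sets.

Set Implicit Arguments.
Unset Strict Implicit.
Unset Printing Implicit Defensive.

Import GRing.Theory.
Local Open Scope classical_set_scope.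
Local Open Scope ring_scope.

(* [pzRingType] is the class of associative unital rings, with the zero ring
   allowed. *)

Definition rideal (R : pzRingType) (c : R) : set R := [set c * x | x in setT].

Definition lideal (R : pzRingType) (c : R) : set R := [set x * c | x in setT].

(* c^{-1}(0), the right annihilator of c. *)
Definition rann (R : pzRingType) (c : R) : set R := [set x | c * x = 0].

(* c_{-1}(0), the left annihilator of c. *)
Definition lann (R : pzRingType) (c : R) : set R := [set x | x * c = 0].

Definition regular_elt (R : pzRingType) (d : R) : Prop :=
  exists z : R, d = d * z * d.

Definition outer_inverse (R : pzRingType) (a b : R) : Prop := b = b * a * b.

Definition inverse_along (R : pzRingType) (a d b : R) : Prop :=
  [/\ outer_inverse a b, rideal b = rideal d & lideal b = lideal d].

Lemma inverse_along_uniq (R : pzRingType) (a d b b' : R) :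
  inverse_along a d b -> inverse_along a d b' -> b = b'.
Proof.
move=> [ob rb lb] [ob' rb' lb'].
have [x _ bE] : rideal b' b by rewrite rb' -rb; exists 1; rewrite ?mulr1.
have [y _ b'E] : lideal b b' by rewrite lb -lb'; exists 1; rewrite ?mul1r.
have e1 : b' * a * b = b by rewrite -bE mulrA -ob'.
have e2 : b' * a * b = b' by rewrite -b'E -!mulrA [b * (a * b)]mulrA -ob.
by rewrite -e1 e2.
Qed.

(* Main.v *)
Require Import Defs.
From HB Require Import structures.
From mathcomp Require Import all_boot all_algebra.
From mathcomp Require Import boolp classical_sets.

Set Implicit Arguments.
Unset Strict Implicit.
Unset Printing Implicit Defensive.

Import GRing.Theory.
Local Open Scope classical_set_scope.
Local Open Scope ring_scope.

(** Both [b] and [d] are regular: [d] by hypothesis, and [b] because the element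
    [a] of which it is an outer inverse is an inner inverse of [b]. For a
    regular element, one-sided ideals and annihilators determine each other:
    taking the annihilator on the opposite side reverses and reflects
    inclusions ([lideal_sub_rann] and [rideal_sub_lann]). Every annihilator
    condition can therefore be traded for an inclusion of principal ideals, and
    each of the conditions becomes a list of the same four inclusions, which
    together say that [b] and [d] generate the same left ideal and the
    same right ideal. As [b] is already an outer inverse of [a], that is what
    being the inverse of [a] along [d] means. *)

(** For [y = y z y], the element [1 - z y] annihilates [y] on the right, so it
    lies in [rann x] as soon as [rann y `<=` rann x]; thus [x = (x z) y]. The
    other direction holds because [x = w y] kills whatever [y] kills. *)
Lemma lideal_sub_rann (R : pzRingType) (x y : R) :
  regular_elt y -> (lideal x `<=` lideal y) = (rann y `<=` rann x).
Proof.
move=> [z yE]; apply/propext; split=> [sub_xy t yt0 | sub_yx _ [r _ <-]].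
  have [w _ xE] : lideal y x by apply: sub_xy; exists 1; rewrite ?mul1r.
  by rewrite /rann /= -xE -mulrA yt0 mulr0.
have /sub_yx : rann y (1 - z * y) by rewrite /rann /= mulrBr mulr1 mulrA -yE subrr.
rewrite /rann /= mulrBr mulr1 => /subr0_eq xE.
by exists (r * x * z) => //; rewrite -!mulrA -xE.
Qed.

(** In the converse ring [R^c], left ideals and right annihilators become right
    ideals and left annihilators, while regularity is self-dual. *)
Lemma rideal_sub_lann (R : pzRingType) (x y : R) :
  regular_elt y -> (rideal x `<=` rideal y) = (lann y `<=` lann x).
Proof.
move=> [z yE]; apply: (@lideal_sub_rann R^c x y).
by exists z; rewrite [LHS]yE -mulrA.
Qed.

Lemma outer_inverse_regular (R : pzRingType) (a b : R) :
  outer_inverse a b -> regular_elt b.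
Proof. by exists a. Qed.

Theorem theorem3p3 (R : pzRingType) (a b d : R)
    (hb : outer_inverse a b) (hd : regular_elt d) :
  [<-> inverse_along a d b;
       [/\ lideal d = lideal b, rideal d `<=` rideal b & lann d `<=` lann b];
       [/\ rideal b = rideal d, lideal d `<=` lideal b & rann d `<=` rann b];
       lideal b = lideal d /\ lann b = lann d;
       [/\ lideal b `<=` lideal d, rideal d `<=` rideal b,
           rann b `<=` rann d & lann d `<=` lann b];
       [/\ lideal d `<=` lideal b, rideal b `<=` rideal d,
           lann b `<=` lann d & rann d `<=` rann b];
       [/\ lideal d `<=` lideal b, rideal d `<=` rideal b,
           rann d `<=` rann b & lann d `<=` lann b];
       rideal b = rideal d /\ rann b = rann d;
       [/\ lideal b `<=` lideal d, rann b `<=` rann d & lann b = lann d];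
       [/\ lideal d `<=` lideal b, rann d `<=` rann b & lann b = lann d];
       [/\ rideal d `<=` rideal b, lann d `<=` lann b & rann b = rann d];
       [/\ rideal b `<=` rideal d, lann b `<=` lann d & rann b = rann d];
       rann b = rann d /\ lann b = lann d].
Proof.
have rb := outer_inverse_regular hb.
rewrite /inverse_along !eqEsubset.
rewrite -!(lideal_sub_rann _ rb) -!(lideal_sub_rann _ hd).
rewrite -!(rideal_sub_lann _ rb) -!(rideal_sub_lann _ hd).
(* Only the four inclusions between ideals are left: abstracting them turns
   the goal into a propositional tautology. *)
move: (lideal b `<=` lideal d) (lideal d `<=` lideal b)
  (rideal b `<=` rideal d) (rideal d `<=` rideal b) => lbd ldb rbd rdb.
by tfae; firstorder.
Qed.
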